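(* Let $G$ be a finite (directed or undirected) graph with adjacency matrix $A(G)$, and let $\zeta_G$ be the zeta function defined (as a formal power series, or for $|u|$ sufficiently small) by $$\zeta_G(u)^{-1}=\prod_{[c]}\left(1-u^{l(c)}\right),$$ where the product is over equivalence classes $[c]$ of primitive cycles of $G$. Then $$\zeta_G(u)^{-1}=\det\left(I-uA(G)\right).$$
   Context: A cycle of $G$ is a closed walk (with basepoint) along edges of $G$, and $l(c)\ge1$ denotes its length, so that the number of cycles of length $i$ is $\operatorname{tr}A(G)^i$. A cycle is primitive if it is not a power (repeated traversal at least twice) of a shorter cycle. Two cycles are equivalent if one is obtained from the other by a rotation (cyclic change of basepoint). *)

(* Defs.v *)
From mathcomp Require Import all_boot all_order all_algebra.
From mathcomp Require Import generic_quotient finmap complex.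
From mathcomp Require Import all_classical all_reals all_analysis.
From mathcomp.analysis.showcase Require Import summability.

Set Implicit Arguments.
Unset Strict Implicit.
Unset Printing Implicit Defensive.

Import Order.TTheory GRing.Theory Num.Theory.
Import numFieldNormedType.Exports.

Local Open Scope classical_set_scope.
Local Open Scope ring_scope.

(* Finite graphs, directed or undirected, in which loops and parallel edges
   are allowed. When [directed] is false, the pair [ends e] is to be read as
   unordered: the edge can be traversed both ways. *)
Record graph := Graph {
  vertex : finType;
  edge : finType;
  directed : bool;
  ends : edge -> vertex * vertex }.

Definition joins (G : graph) (e : edge G) (x y : vertex G) : bool :=
  (ends e == (x, y)) || (~~ directed G && (ends e == (y, x))).

(* Every edge from x to y contributes 1 to the (x, y) entry; in particular a
   loop contributes 1 to the diagonal, in the undirected case as well, and it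
   gives rise to a single arc below. *)
Definition adjmx (R : nzRingType) (G : graph) : 'M[R]_#|vertex G| :=
  \matrix_(i, j) #|[pred e : edge G | joins e (enum_val i) (enum_val j)]|%:R.

(* An arc (x, e, y) is the traversal of the edge e from x to y. *)
Definition arc (G : graph) : Type :=
  {a : vertex G * edge G * vertex G | joins a.1.2 a.1.1 a.2}.

Definition src (G : graph) (a : arc G) : vertex G := (val a).1.1.
Definition tgt (G : graph) (a : arc G) : vertex G := (val a).2.

(* Closed walks of length at least 1, based at the source of the first arc. *)
Definition gcycle (G : graph) : Type :=
  {c : seq (arc G) | (c != [::]) && cycle (fun a b => tgt a == src b) c}.

Definition is_power (G : graph) (c : gcycle G) : Prop :=
  exists (m : nat) (d : gcycle G),
    (2 <= m)%N /\ val c = flatten (nseq m (val d)).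

Definition prim_cycle (G : graph) : Type :=
  {c : gcycle G | ~~ `[< is_power c >]}.

Definition arcs (G : graph) (c : prim_cycle G) : seq (arc G) := val (val c).

Definition rotated (G : graph) : rel (prim_cycle G) :=
  fun c d => `[< exists k : nat, arcs d = rot k (arcs c) >].

Lemma rotated_refl (G : graph) : reflexive (@rotated G).
Proof. by move=> c; apply/asboolP; exists 0%N; rewrite rot0. Qed.

Lemma rotated_sym (G : graph) : symmetric (@rotated G).
Proof.
suff H (c d : prim_cycle G) : rotated c d -> rotated d c.
  by move=> c d; apply/idP/idP; exact: H.
move=> /asboolP [k ek]; apply/asboolP; exists (size (arcs d) - k)%N.
by rewrite ek -/(rotr _ _) rotK.
Qed.

Lemma rotated_trans (G : graph) : transitive (@rotated G).
Proof.
move=> d c b /asboolP [k ek] /asboolP [l el]; apply/asboolP.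
suff [m em] : exists m, rot l (rot k (arcs c)) = rot m (arcs c).
  by exists m; rewrite el ek.
have [kc|ck] := leqP k (size (arcs c)); last first.
  by exists l; rewrite (rot_oversize (ltnW ck)).
have [lc|cl] := leqP l (size (arcs c)); last first.
  by exists k; rewrite (@rot_oversize _ l) // size_rot ltnW.
by rewrite rot_add_mod //; eexists.
Qed.

Canonical rotated_equiv (G : graph) :=
  EquivRel (@rotated G) (@rotated_refl G) (@rotated_sym G) (@rotated_trans G).

Definition prim_class (G : graph) : Type := {eq_quot (rotated_equiv G)}%qT.

Definition class_len (G : graph) (c : prim_class G) : nat :=
  size (arcs (repr c)).

Lemma class_lenE (G : graph) (c : prim_cycle G) :
  class_len (\pi_(prim_class G) c)%qT = size (arcs c).
Proof.
rewrite /class_len; have : rotated (repr (\pi_(prim_class G) c)%qT) c.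
  by have /eqmodP := reprK (\pi_(prim_class G) c)%qT.
by move=> /asboolP [k ->]; rewrite size_rot.
Qed.

(* A formal power series is the sequence of its coefficients. *)
Definition fps (R : nzRingType) : Type := nat -> R.

Definition fps_mul (R : nzRingType) (f g : fps R) : fps R :=
  fun n => \sum_(i < n.+1) f i * g (n - i)%N.

Definition fps_poly (R : nzRingType) (p : {poly R}) : fps R := fun n => p`_n.

Definition fps_inverse (R : nzRingType) (f g : fps R) : Prop :=
  fps_mul f g = fps_poly 1 /\ fps_mul g f = fps_poly 1.

(* Unconditional convergence of an infinite product of polynomials to a power
   series: each coefficient is stationary along the finite subproducts. *)
Definition fps_prod_cvg (R : comNzRingType) (I : choiceType)
    (F : I -> {poly R}) (f : fps R) : Prop :=
  forall n : nat, \forall S \near @totally I,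
    (\prod_(i <- (S : {fset I})) F i)`_n = f n.

Definition is_zeta_fps (G : graph) (z : fps int) : Prop :=
  exists2 f : fps int, fps_inverse z f &
    fps_prod_cvg (fun c : prim_class G => 1 - 'X^(class_len c)) f.

Definition is_zeta_at (R : realType) (G : graph) (u z : R[i]) : Prop :=
  z != 0 /\
  (fun S : {fset prim_class G} => \prod_(c <- S) (1 - u ^+ class_len c))
    @ totally --> (z^-1 : R[i]^o).

(* Main.v *)
(* Both sides are power series with constant term 1, so it suffices that their
   logarithmic derivatives agree. By Jacobi's formula, that of det(1 - X A) is
   -sum_j tr(A^j) X^(j-1); that of the product is -sum_j N_j X^(j-1) with
   N_j = sum of l(c) over the classes c such that l(c) divides j. A closed walk of
   length j is a periodic sequence of arcs, and its minimal period cuts out its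
   primitive root; hence it is determined by a class c with l(c) | j and one of the
   l(c) starting points, so N_j = tr(A^j).

   For numerical u, there are at most q^k classes of length k, where q is the
   number of arcs. So the coefficients of all the finite subproducts obey one common
   geometric bound, and as these coefficients are eventually those of det(1 - X A),
   the values at a small u converge to det(1 - u A). *)
Require Import Defs.
From mathcomp Require Import all_boot all_order all_algebra.
From mathcomp Require Import complex.
From mathcomp Require Import all_classical all_reals all_analysis.
From mathcomp Require Import generic_quotient finmap zify ring.
From mathcomp.analysis.showcase Require Import summability.
(* [path.arc] hides [Defs.arc]. *)
Import Defs.
Import Order.TTheory GRing.Theory Num.Theory.
Import numFieldNormedType.Exports.
Local Open Scope classical_set_scope.
Local Open Scope ring_scope.

Set Implicit Arguments.
Unset Strict Implicit.
Unset Printing Implicit Defensive.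

(** * Logarithmic derivatives *)

Lemma deriv_prod (R : comNzRingType) (I : finType) (F : I -> {poly R}) :
  (\prod_i F i)^`() = \sum_i (F i)^`() * \prod_(j | j != i) F j.
Proof.
suff H (s : seq I) : uniq s -> (\prod_(i <- s) F i)^`() =
    \sum_(i <- s) (F i)^`() * \prod_(j <- s | j != i) F j.
  by rewrite H ?index_enum_uniq.
elim: s => [|x s IHs] /=; first by rewrite !big_nil derivC.
case/andP=> xs us; rewrite !big_cons derivM eqxx IHs //= mulr_sumr.
congr (_ * _ + _).
  rewrite [RHS]big_seq_cond [LHS]big_seq; apply: eq_bigl => j.
  by case: eqVneq => [->|_]; rewrite ?andbT // (negPf xs).
rewrite [LHS]big_seq [RHS]big_seq; apply: eq_bigr => i si.
rewrite big_cons ifT; first by rewrite mulrCA.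
by apply: contraNneq xs => ->.
Qed.

(** Jacobi's formula: the Leibniz expansion is differentiated one row at a time, and the determinant
    of [Mr i], where row [i] is differentiated, is expanded along that row. *)
Lemma deriv_det (R : comNzRingType) n (M : 'M[{poly R}]_n) :
  (\det M)^`() = \tr (map_mx (@deriv R) M *m \adj M).
Proof.
pose Mr i := \matrix_(k, j) if k == i then (M k j)^`() else M k j.
have detMr i : \det (Mr i) = (map_mx (@deriv R) M *m \adj M) i i.
  rewrite (expand_det_row _ i) mxE; apply: eq_bigr => j _; rewrite !mxE eqxx.
  congr (_ * (_ * \det _)); apply/matrixP => k l.
  by rewrite !mxE eq_sym (negPf (neq_lift i k)).
rewrite /mxtrace -(eq_bigr _ (fun i _ => detMr i)) /determinant raddf_sum /=.
rewrite exchange_big /=; apply: eq_bigr => s _.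
rewrite -mulr_sumr derivM deriv_prod.
rewrite (_ : ((-1) ^+ perm.odd_perm s : {poly R})^`() = 0) ?mul0r ?add0r; last first.
  by case: (perm.odd_perm s); rewrite ?derivN derivC ?oppr0.
congr (_ * _); apply: eq_bigr => i _; rewrite [RHS](bigD1 i) //= !mxE eqxx.
by congr (_ * _); apply: eq_bigr => j /negPf nj; rewrite mxE nj.
Qed.

(* [M] agrees with [- X P' / P] up to [X^N]. *)
Definition logderiv (R : comNzRingType) (N : nat) (P M : {poly R}) :=
  exists r, 'X * P^`() + M * P = 'X^N * r.

Lemma logderiv1 (R : comNzRingType) N : logderiv N (1 : {poly R}) 0.
Proof. by exists 0; rewrite derivC !mulr0 mul0r addr0. Qed.

Lemma logderivM (R : comNzRingType) N (P Q M M' : {poly R}) :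
  logderiv N P M -> logderiv N Q M' -> logderiv N (P * Q) (M + M').
Proof.
move=> [r Hr] [s Hs]; exists (r * Q + P * s).
have -> : 'X^N * (r * Q + P * s) = ('X^N * r) * Q + P * ('X^N * s) by ring.
by rewrite derivM -Hr -Hs; ring.
Qed.

Lemma logderiv_prod (R : comNzRingType) N (I : Type) (s : seq I)
    (P M : I -> {poly R}) : (forall i, logderiv N (P i) (M i)) ->
  logderiv N (\prod_(i <- s) P i) (\sum_(i <- s) M i).
Proof.
move=> H; elim: s => [|x s IHs]; first by rewrite !big_nil; exact: logderiv1.
by rewrite !big_cons; exact: logderivM.
Qed.

(** The coefficient of X^(k+1) in the relation expresses (k+1) P_(k+1) through M and lower
    coefficients of P, because [M0] removes the term in P_(k+1) from the convolution. The integers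
    have no torsion, so the factor k+1 cancels. *)
Lemma logderiv_inj (N : nat) (P Q M M' : {poly int}) :
  P`_0 = 1 -> Q`_0 = 1 -> M`_0 = 0 ->
  (forall k, (k < N)%N -> M`_k = M'`_k) ->
  logderiv N P M -> logderiv N Q M' ->
  forall k, (k < N)%N -> P`_k = Q`_k.
Proof.
move=> P0 Q0 M0 MM' [r HP] [s HQ]; elim/ltn_ind => -[|k] IHk kN.
  by rewrite P0.
have E (T U t : {poly int}) : 'X * T^`() + U * T = 'X^N * t ->
    T`_k.+1 *+ k.+1 = - \sum_(i < k.+2) U`_i * T`_(k.+1 - i)%N.
  move=> /(congr1 (fun p : {poly int} => p`_k.+1)).
  rewrite coefD coefXM /= coef_deriv coefM coefXnM kN => /eqP.
  by rewrite addr_eq0 => /eqP.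
have : P`_k.+1 *+ k.+1 = Q`_k.+1 *+ k.+1.
  rewrite (E _ _ _ HP) (E _ _ _ HQ); congr (- _).
  apply: eq_bigr => -[[|i] /= ik] _; first by rewrite -MM' ?M0 ?mul0r //; lia.
  by rewrite MM' ?IHk //; lia.
by move/eqP; rewrite -subr_eq0 -mulrnBl mulrn_eq0 /= subr_eq0 => /eqP.
Qed.

Lemma logderiv_congr (R : comNzRingType) (N : nat) (P M M' D : {poly R}) :
  M = M' + 'X^N * D -> logderiv N P M -> logderiv N P M'.
Proof.
move=> -> [r Hr]; exists (r - D * P).
by rewrite mulrBr -Hr; ring.
Qed.

Lemma take_poly_congr (R : comNzRingType) (N : nat) (M : {poly R}) :
  M = take_poly N M + 'X^N * drop_poly N M.
Proof. by rewrite [X in _ + X]mulrC poly_take_drop. Qed.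

(** For P = 1 - X^l, the series -X P'/P is l X^l / (1 - X^l), the sum of l X^(lm) over m >= 1. *)
Lemma logderiv_1subXn (R : comNzRingType) (N l : nat) : (0 < l)%N ->
  logderiv N (1 - 'X^l : {poly R})
    (\poly_(k < N) (l%:R *+ ((0 < k)%N && (l %| k)%N))).
Proof.
case: l => // l _.
(* [N] terms of the series suffice: all further exponents exceed [N]. *)
pose M : {poly R} := \sum_(i < N) l.+1%:R * 'X^(l.+1) * 'X^(l.+1) ^+ i.
have -> : \poly_(k < N) (l.+1%:R *+ ((0 < k)%N && (l.+1 %| k)%N)) = take_poly N M.
  apply/polyP => k; rewrite coef_poly coef_take_poly; case: ltnP => // kN.
  rewrite /M coef_sum.
  under eq_bigr => i _.
    rewrite -mulrA -exprS -exprM mulr_natl coefMn coefXn -mulrnA mulnC mulrnA.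
    over.
  have [/dvdnP [m Em]|nd] := boolP (l.+1 %| k)%N; last first.
    rewrite andbF mulr0n big1 // => i _; case: eqVneq => [E|_]; last by rewrite mulr0n.
    by rewrite E dvdn_mulr in nd.
  subst k; rewrite muln_gt0 andbT; case: m kN => [|m] kN.
    by rewrite mulr0n big1 // => i _; rewrite mul0n mulr0n.
  have mN : (m < N)%N by apply: leq_trans (ltnW kN); rewrite leq_pmulr.
  rewrite (bigD1 (Ordinal mN)) //= mulnC eqxx mulr1n big1 ?addr0 // => i.
  rewrite -val_eqE /= eqn_pmul2l // eqSS eq_sym => /negPf ->.
  by rewrite mulr0n.
apply: (logderiv_congr (take_poly_congr N M)).
(* The geometric sum telescopes against 1 - X^(l+1); its last term survives, and X^N is split off
   from it. *)
exists (- (l.+1%:R * 'X^(N * l) * 'X^(l.+1))).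
rewrite derivB derivC derivXn sub0r /= /M -mulr_sumr.
have := subrX1 ('X^(l.+1) : {poly R}) N.
move: (\sum_(i < N) _) => S E.
have {E} SE : S * (1 - 'X^(l.+1)) = 1 - 'X^(l.+1) ^+ N.
  by rewrite -(opprB _ 1) mulrN mulrC -E opprB.
rewrite -mulrA SE -mulr_natl -exprM mulSn exprD exprS [(l * N)%N]mulnC; ring.
Qed.

(** The geometric sum telescopes against 1 - B; multiplying by the adjugate avoids inverting 1 -
    B. *)
Lemma mulmx_adj_geometric (R : comNzRingType) (n N : nat) (B : 'M[R]_n) :
  \det (1%:M - B) *: \sum_(i < N) iter i.+1 (mulmx B) 1%:M =
  \adj (1%:M - B) *m (B - iter N.+1 (mulmx B) 1%:M).
Proof.
have -> : B - iter N.+1 (mulmx B) 1%:M =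
   (1%:M - B) *m \sum_(i < N) iter i.+1 (mulmx B) 1%:M.
  rewrite mulmx_sumr -{1}[B]mulmx1 -[B *m 1%:M]/(iter 1 (mulmx B) 1%:M).
  elim: N => [|N IHN]; first by rewrite subrr big_ord0.
  rewrite big_ord_recr /= -IHN mulmxBl mul1mx /=.
  by rewrite addrA subrK.
by rewrite mulmxA mul_adj_mx mul_scalar_mx.
Qed.

(** With B = X A, Jacobi's formula gives X P' = -tr(adj(1 - B) B), and the geometric sum gives M P =
    tr(adj(1 - B) (B - B^(N+1))). Only the term in B^(N+1) remains, and it is divisible by
    X^(N+1). *)
Lemma logderiv_det (R : comNzRingType) (N n : nat) (A : 'M[R]_n) :
  logderiv N (\det (1%:M - 'X *: map_mx polyC A))
     (\poly_(k < N) if k is k'.+1 then \tr (iter k (mulmx A) 1%:M) else 0).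
Proof.
pose B := 'X *: map_mx polyC A.
have BX k : iter k (mulmx B) 1%:M = 'X^k *: map_mx polyC (iter k (mulmx A) 1%:M).
  elim: k => [|k /= ->]; first by rewrite expr0 scale1r map_mx1.
  by rewrite /B -scalemxAl -scalemxAr scalerA map_mxM exprS.
pose M := \tr (\sum_(i < N) iter i.+1 (mulmx B) 1%:M).
have -> : \poly_(k < N) (if k is k'.+1 then \tr (iter k (mulmx A) 1%:M) else 0)
  = take_poly N M.
  apply/polyP => k; rewrite coef_poly coef_take_poly; case: ltnP => // kN.
  rewrite /M raddf_sum coef_sum /=.
  have trE i : (\tr (iter i.+1 (mulmx B) 1%:M))`_k =
      \tr (iter i.+1 (mulmx A) 1%:M) *+ (k == i.+1).
    by rewrite BX mxtraceZ trace_map_mx coefMC coefXn mulr_natl.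
  case: k kN trE => [|k] kN trE.
    by rewrite big1 // => i _; rewrite trE mulr0n.
  rewrite (bigD1 (Ordinal (ltnW kN))) //= trE eqxx mulr1n big1 ?addr0 // => i.
  by rewrite -val_eqE /= trE eqSS eq_sym => /negPf ->.
apply: (logderiv_congr (take_poly_congr N M)).
exists (- \tr (\adj (1%:M - B) *m ('X *: map_mx polyC (iter N.+1 (mulmx A) 1%:M)))).
rewrite -/B deriv_det.
have -> : map_mx (@deriv R) (1%:M - B) = - map_mx polyC A.
  apply/matrixP => i j; rewrite !mxE derivB derivM derivX derivC mulr0 addr0 mul1r.
  by case: (i == j); rewrite derivC sub0r.
have /(congr1 (@mxtrace _ _)) := mulmx_adj_geometric N B.
rewrite mxtraceZ -/M mulrC => ->.
rewrite mulmxBr raddfB /= -/(iter N.+1 (mulmx B) 1%:M) BX.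
rewrite mulNmx raddfN /= [\tr (map_mx _ _ *m _)]mxtrace_mulC.
rewrite {2}/B exprSr -scalerA -!scalemxAr !mxtraceZ; ring.
Qed.

(** * Periodic words and primitive roots *)

Section PeriodicWords.
Variables (T : eqType) (x0 : T).
Implicit Types (s : seq T) (f g : nat -> T) (i k m p q : nat).
Local Open Scope nat_scope.

Definition periodic f p := forall i, f (i + p) = f i.

(** On periodic extensions a rotation becomes a shift of the argument, and a word and its positive
    powers have the same extension. *)
Definition pword s i := nth x0 s (i %% size s).

Lemma pword_periodic s : periodic (pword s) (size s).
Proof. by move=> i; rewrite /pword modnDr. Qed.

Lemma mkseq_pword s : mkseq (pword s) (size s) = s.
Proof.
apply: (@eq_from_nth _ x0); rewrite size_mkseq // => i si.
by rewrite nth_mkseq // /pword modn_small.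
Qed.

Lemma periodicM f p m : periodic f p -> periodic f (m * p).
Proof.
move=> fp i; elim: m => [|m IHm]; first by rewrite addn0.
by rewrite mulSn addnCA addnC fp.
Qed.

Lemma periodic_mod f p i : periodic f p -> f (i %% p) = f i.
Proof. by move=> fp; rewrite [in RHS](divn_eq i p) addnC (periodicM _ fp). Qed.

Lemma pword_mkseq f p : 0 < p -> periodic f p -> pword (mkseq f p) =1 f.
Proof.
move=> p0 fp i; rewrite /pword size_mkseq nth_mkseq ?ltn_mod //.
exact: periodic_mod.
Qed.

Lemma flatten_nseqE m s :
  flatten (nseq m s) = mkseq (pword s) (m * size s).
Proof.
elim: m => [|m IHm] //=; rewrite IHm mulSn /mkseq iotaD map_cat add0n.
congr (_ ++ _); first by rewrite -[LHS]mkseq_pword.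
have -> : iota (size s) (m * size s) = map (addn (size s)) (iota 0 (m * size s)).
  by rewrite -iotaDl addn0.
rewrite -map_comp; apply: eq_map => i /=.
by rewrite addnC pword_periodic.
Qed.

(** Bezout without subtraction: km p = kn q + gcd(p, q). *)
Lemma periodic_gcd f p q : 0 < p -> periodic f p -> periodic f q ->
  periodic f (gcdn p q).
Proof.
move=> p0 fp fq i; case: (egcdnP q p0) => km kn E _.
by rewrite -(periodicM kn fq) -addnA (addnC (gcdn _ _)) -E (periodicM km fp).
Qed.

Lemma rotE i s : i <= size s ->
  rot i s = mkseq (fun k => pword s (k + i)) (size s).
Proof.
move=> si; apply: (@eq_from_nth _ x0); rewrite size_rot ?size_mkseq // => k ks.
rewrite nth_mkseq // /rot nth_cat size_drop nth_drop /pword.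
have [ki|ki] := ltnP; first by rewrite modn_small addnC //; lia.
rewrite nth_take; last by lia.
have -> : k + i = k - (size s - i) + size s by lia.
by rewrite modnDr modn_small //; lia.
Qed.

Lemma cycle_pword (e : rel T) s : s != [::] ->
  cycle e s <-> forall i, e (pword s i) (pword s i.+1).
Proof.
case: s => // a s _.
have lastE i : i <= size s -> nth x0 (rcons s a) i = pword (a :: s) i.+1.
  rewrite nth_rcons /pword /= leq_eqVlt => /orP[/eqP ->|si].
    by rewrite ltnn eqxx modnn.
  by rewrite si modn_small.
rewrite /=; split=> [/(pathP x0) H i|H]; last first.
  apply/(pathP x0) => i; rewrite size_rcons ltnS => si.
  rewrite lastE // -rcons_cons nth_rcons /= ltnS si.
  by have := H i; rewrite {1}/pword /= modn_small.
have il : i %% (size s).+1 < (size s).+1 by rewrite ltn_mod.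
have := H (i %% (size s).+1); rewrite size_rcons => /(_ il).
rewrite lastE // -rcons_cons nth_rcons /= il /pword /=.
by rewrite -[(i %% _).+1]addn1 modnDml addn1.
Qed.

(** A shift by [j] is undone by a further shift by j (q - 1), since j q is a period of [g]. *)
Lemma eq_shift_pword f g p q i j : 0 < q -> periodic f p -> periodic g q ->
  (forall k, f (k + i) = g (k + j)) ->
  periodic g p /\ exists a, forall k, g k = f (k + a).
Proof.
move=> q0 fp gq E.
have gE k : g k = f (k + (j * q.-1 + i)).
  rewrite addnA E -addnA -{2}[j]muln1 -mulnDr addn1 prednK //.
  by rewrite (periodicM _ gq).
split; last by exists (j * q.-1 + i).
by move=> k; rewrite !gE addnAC fp.
Qed.

End PeriodicWords.

Definition link (G : graph) : rel (arc G) := fun a b => tgt a == src b.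

Definition to_gcycle (G : graph) (s : seq (arc G))
    (H : (s != [::]) && cycle (@link G) s) : gcycle G :=
  exist (fun c : seq (arc G) => (c != [::]) && cycle (@link G) c) s H.

Definition to_prim (G : graph) (c : gcycle G)
    (H : ~~ `[< is_power c >]) : prim_cycle G :=
  exist (fun c : gcycle G => ~~ `[< is_power c >]) c H.

Section PrimitiveRoots.
Variables (G : graph) (x0 : arc G).
Local Notation pw := (pword x0).
Local Open Scope nat_scope.

Lemma gcycle_gt0 (c : gcycle G) : 0 < size (val c).
Proof. by have /andP[] := valP c; case: (val c). Qed.

Lemma gcycleP (f : nat -> arc G) p : 0 < p -> periodic f p ->
  (forall i, link (f i) (f i.+1)) ->
  exists c : gcycle G, val c = mkseq f p.
Proof.
move=> p0 fp H.
have Hc : (mkseq f p != [::]) && cycle (@link G) (mkseq f p).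
  have Hn : mkseq f p != [::] by rewrite -size_eq0 size_mkseq -lt0n.
  by rewrite Hn; apply/(cycle_pword x0) => // i; rewrite !pword_mkseq.
by exists (to_gcycle Hc).
Qed.

(** The gcd g of q and the length l is again a period, so c is the (l/g)-th power of its prefix of
    length g. Primitivity forces g = l. *)
Lemma prim_cycle_period (c : prim_cycle G) q :
  periodic (pw (arcs c)) q -> size (arcs c) %| q.
Proof.
move=> cq; have l0 : 0 < size (arcs c) := gcycle_gt0 (val c).
set l := size (arcs c); set g := gcdn l q.
have cg : periodic (pw (arcs c)) g by apply: periodic_gcd => //; exact: pword_periodic.
have g0 : 0 < g by rewrite gcdn_gt0 l0.
have gl : g %| l by exact: dvdn_gcdl.
have /andP[cn cc] := valP (val c).
have [d Ed] := gcycleP g0 cg ((cycle_pword x0 _ cn).1 cc).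
have [l2|] := leqP 2 (l %/ g); last first.
  have := divnK gl; case: (l %/ g) => [|[|]] //; first by lia.
  by rewrite mul1n -/l => <- _; exact: dvdn_gcdr.
have /negP[] := valP c; apply/asboolP; exists (l %/ g), d; split=> //.
rewrite (flatten_nseqE x0) Ed size_mkseq divnK // -[LHS](mkseq_pword x0).
by apply: eq_map => i; rewrite pword_mkseq.
Qed.

(** Strong induction on the length: the base of a proper power is shorter. *)
Lemma primitive_root (c : gcycle G) : exists m (d : prim_cycle G),
  val c = mkseq (pw (arcs d)) (m * size (arcs d)).
Proof.
have [n] := ubnP (size (val c)); elim: n c => // n IHn c cn.
have [|np] := boolP `[< is_power c >]; last first.
  by exists 1%N, (to_prim np); rewrite mul1n mkseq_pword.
move=> /asboolP [m [d [m2 Ec]]]; rewrite (flatten_nseqE x0) in Ec.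
have d0 := gcycle_gt0 d.
have [|m' [e Ee]] := IHn d.
  by move: cn; rewrite Ec size_mkseq ltnS; apply/leq_trans/ltn_Pmull.
exists (m * m'), e; rewrite Ec Ee size_mkseq mulnA.
have m'0 : 0 < m' * size (arcs e) by move: d0; rewrite Ee size_mkseq.
by apply: eq_map => i; rewrite pword_mkseq //; apply/periodicM/pword_periodic.
Qed.

(* The closed walk of length [j] around [c] from its [i]-th arc on, provided that
   [class_len c] divides [j]. *)
Definition turn (c : prim_class G) (j i : nat) : seq (arc G) :=
  mkseq (fun k => pw (arcs (repr c)) (k + i)) j.

Lemma class_len_gt0 (c : prim_class G) : 0 < class_len c.
Proof. exact: gcycle_gt0 (val (repr c)). Qed.

(** The two periodic extensions agree up to a shift, so each has the period of the other and the
    lengths divide each other. The shift is then a rotation between the representatives. Within one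
    class, the difference of the offsets is a period below the length, hence 0. *)
Lemma turn_inj (c c' : prim_class G) j i i' : 0 < j ->
  class_len c %| j -> class_len c' %| j -> i < class_len c -> i' < class_len c' ->
  turn c j i = turn c' j i' -> c = c' /\ i = i'.
Proof.
move=> j0 cj cj' ic ic' E.
set f := pw (arcs (repr c)); set g := pw (arcs (repr c')).
have fp : periodic f (class_len c) := pword_periodic x0 _.
have gp : periodic g (class_len c') := pword_periodic x0 _.
have fj : periodic f j by rewrite -(divnK cj); exact: periodicM.
have gj : periodic g j by rewrite -(divnK cj'); exact: periodicM.
have fg k : f (k + i) = g (k + i').
  have kj : k %% j < j by rewrite ltn_mod.
  have := congr1 (fun s => nth x0 s (k %% j)) E; rewrite !nth_mkseq //.
  have kE u : k + u = k %% j + u + k %/ j * j by rewrite {1}(divn_eq k j); lia.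
  by rewrite (kE i) (kE i') (periodicM _ fj) (periodicM _ gj).
have [gc [a ga]] := eq_shift_pword (class_len_gt0 c') fp gp fg.
have [fc' _] := eq_shift_pword (class_len_gt0 c) gp fp (fun k => esym (fg k)).
have ll : class_len c = class_len c'.
  by apply/eqP; rewrite eqn_dvd !prim_cycle_period.
have cc : c = c'.
  rewrite -[c]reprK -[c']reprK; apply/eqmodP; apply/asboolP.
  (* The shift is reduced modulo the length, as [rot] is the identity beyond it. *)
  exists (a %% class_len c).
  have al : a %% class_len c <= size (arcs (repr c)).
    by rewrite ltnW // ltn_mod class_len_gt0.
  rewrite (rotE x0 al) -[LHS](mkseq_pword x0) -[size _]/(class_len c') -ll.
  apply: eq_map => k; rewrite -/g -/f ga -(periodic_mod (k + a) fp).
  by rewrite -modnDmr periodic_mod.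
split=> //; subst c'.
(* To see that v - u is a period, go forward by u times the length; this stands for going back by
   u. *)
have step u v : u <= v -> v < class_len c -> (forall k, f (k + u) = f (k + v)) -> u = v.
  move=> uv vl H; suff /dvdn_leq : class_len c %| v - u by lia.
  apply: prim_cycle_period => k; rewrite -/f.
  rewrite -(periodicM u fp) -[RHS](periodicM u fp).
  have lc := class_len_gt0 c; rewrite -[class_len c]prednK //.
  have -> : k + (v - u) + u * (class_len c).-1.+1 = k + u * (class_len c).-1 + v by lia.
  by rewrite -H mulnS; congr f; lia.
by have [ii|ii] := leqP i i'; [exact: step fg|apply/esym; apply: step (ltnW ii) _ _].
Qed.

Lemma turn_surj (s : seq (arc G)) : s != [::] -> cycle (@link G) s ->
  exists c i, [/\ class_len c %| size s, i < class_len c & s = turn c (size s) i].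
Proof.
move=> sn sc; have Hc : (s != [::]) && cycle (@link G) s by rewrite sn.
have [m [d /= Es]] := primitive_root (to_gcycle Hc).
pose c : prim_class G := (\pi_(prim_class G) d)%qT.
have /asboolP [k Ek] : rotated (repr c) d by have /eqmodP := reprK c.
have [i il Ei] : exists2 i, i < class_len c & arcs d = rot i (arcs (repr c)).
  (* A rotation by at least the length does nothing, so it counts as offset 0. *)
  have [kl|kl] := ltnP k (class_len c); first by exists k.
  by exists 0; [exact: class_len_gt0|rewrite rot0 Ek rot_oversize].
have ld : size (arcs d) = class_len c by rewrite Ei size_rot.
exists c, i; rewrite {1 2}Es size_mkseq ld dvdn_mull //; split=> //.
rewrite Es ld /turn size_mkseq; apply: eq_map => k'.
rewrite Ei (rotE x0 (ltnW il)) pword_mkseq ?class_len_gt0 // => t.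
by rewrite addnAC pword_periodic.
Qed.

Lemma turn_cycle (c : prim_class G) j i : 0 < j -> class_len c %| j ->
  cycle (@link G) (turn c j i).
Proof.
move=> j0 cj; have /andP[cn cc] := valP (val (repr c)).
have fj : periodic (fun k => pw (arcs (repr c)) (k + i)) j.
  by move=> k; rewrite addnAC -(divnK cj) periodicM //; exact: pword_periodic.
apply/(cycle_pword x0) => [|k]; first by rewrite -size_eq0 size_mkseq -lt0n.
rewrite !pword_mkseq // addSn; exact: ((cycle_pword x0 _ cn).1 cc).
Qed.

End PrimitiveRoots.

(** * Counting *)

Lemma big_tuple_cons (R : nmodType) (T : finType) n (F : n.+1.-tuple T -> R) :
  \sum_t F t = \sum_a \sum_(t : n.-tuple T) F (cons_tuple a t).
Proof.
rewrite pair_bigA /= (reindex (fun p : T * n.-tuple T => cons_tuple p.1 p.2)) //=.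
exists (fun t : n.+1.-tuple T => (thead t, behead_tuple t)) => [[a t]|t] _.
  by congr (_, _); apply: val_inj.
by apply: val_inj; case/tupleP: t.
Qed.

Section CountingWalks.
Variables (R : nzRingType) (G : graph).

Fixpoint walk (x : vertex G) (s : seq (arc G)) (y : vertex G) : bool :=
  if s is a :: s' then (x == src a) && walk (tgt a) s' y else x == y.

Lemma cycle_walk (a : arc G) (s : seq (arc G)) :
  cycle (@link G) (a :: s) = walk (tgt a) s (src a).
Proof.
rewrite /=; elim: s {1 3}a => [|c s IHs] b /=; first by rewrite andbT.
by rewrite IHs.
Qed.

(** Once its two ends are fixed, an arc is determined by its edge; so an undirected loop is counted
    once on both sides. *)
Lemma adjmx_arcs i j : adjmx R G i j =
  \sum_(a : arc G) ((enum_val i == src a) && (enum_val j == tgt a))%:R.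
Proof.
pose P := [pred a : arc G | (enum_val i == src a) && (enum_val j == tgt a)].
transitivity (#|P|%:R : R); last first.
  rewrite -sum1_card natr_sum big_mkcond; apply: eq_bigr => a _.
  by rewrite inE; case: ifP.
rewrite mxE -(@card_in_image _ _ (fun a : arc G => (val a).1.2)) => [|a b]; last first.
  case: a b => [[[x e] y] Ha] [[[x' e'] y'] Hb]; rewrite !inE /src /tgt /=.
  case/andP=> /eqP ex /eqP ey /andP[/eqP ex' /eqP ey'] ee'; apply: val_inj => /=.
  by rewrite -ex -ey -ex' -ey' ee'.
congr (_%:R); apply: eq_card => e; rewrite inE; apply/idP/fintype.imageP => [He|[a]].
  exists (exist (fun a => joins a.1.2 a.1.1 a.2) (enum_val i, e, enum_val j) He) => //.
  by rewrite inE /src /tgt /= !eqxx.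
by rewrite inE => /andP[/eqP -> /eqP ->] ->; exact: valP a.
Qed.

Lemma iter_adjmx n i j : iter n (mulmx (adjmx R G)) 1%:M i j =
  \sum_(t : n.-tuple (arc G)) (walk (enum_val i) t (enum_val j))%:R.
Proof.
elim: n i => [|n IHn] i /=.
  rewrite mxE (big_pred1 [tuple]) => [|t]; last first.
    by rewrite [t]tuple0 /= eqxx.
  by rewrite /= (inj_eq enum_val_inj).
rewrite mxE big_tuple_cons.
under eq_bigr => k _ do rewrite adjmx_arcs mulr_suml.
rewrite exchange_big; apply: eq_bigr => a _ /=.
rewrite (bigD1 (enum_rank (tgt a))) //= big1 ?addr0 => [|k nk]; last first.
  have /negPf -> : enum_val k != tgt a by apply: contra nk => /eqP <-; rewrite enum_valK.
  by rewrite andbF mul0r.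
rewrite enum_rankK eqxx andbT IHn mulr_sumr enum_rankK.
by apply: eq_bigr => t _; rewrite -natrM mulnb.
Qed.

(** A closed walk is counted at exactly one diagonal entry, that of the source of its first arc.
    Length 0 is excluded, where the trace would count vertices. *)
Lemma mxtrace_iter_adjmx n : \tr (iter n.+1 (mulmx (adjmx R G)) 1%:M) =
  #|[pred t : n.+1.-tuple (arc G) | cycle (@link G) t]|%:R.
Proof.
rewrite -[X in _ = X%:R]sum1_card natr_sum [RHS]big_mkcond /mxtrace.
rewrite (eq_bigr _ (fun i _ => iter_adjmx n.+1 i i)).
rewrite exchange_big /=; apply: eq_bigr => -[[//|a t] Ht] _.
rewrite inE [tval _]/= cycle_walk /=.
rewrite (bigD1 (enum_rank (src a))) //= big1 ?addr0 => [|k nk].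
  by rewrite enum_rankK eqxx /=; case: walk.
have /negPf -> // : enum_val k != src a.
by apply: contra nk => /eqP <-; rewrite enum_valK.
Qed.

End CountingWalks.

Section CountingClasses.
Variable G : graph.
Implicit Types (c : prim_class G) (S : seq (prim_class G)).
Local Open Scope nat_scope.

(** The left side counts pairs of a class and an offset below its length; [turn] maps these
    bijectively onto the closed walks of length n+1. *)
Lemma sum_class_len S n : uniq S ->
  (forall c, class_len c %| n.+1 -> c \in S) ->
  \sum_(c <- S | class_len c %| n.+1) class_len c =
  #|[pred t : n.+1.-tuple (arc G) | cycle (@link G) t]|.
Proof.
(* [turn] needs a default arc; in a graph without arcs both sides are 0. *)
move=> uS cover; have [x0 _|no_arc] := pickP (@predT (arc G)); last first.
  rewrite eq_card0 ?big1 // => [c _|t]; last by have := no_arc (thead t).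
  by have := class_len_gt0 c; rewrite /class_len; case: arcs => // a; have := no_arc a.
pose W := [seq turn x0 c n.+1 i | c <- [seq c <- S | class_len c %| n.+1],
                                  i <- iota 0 (class_len c)].
pose V := [seq val t | t <- enum [pred t : n.+1.-tuple (arc G) | cycle (@link G) t]].
have uV : uniq V by rewrite map_inj_uniq ?enum_uniq //; exact: val_inj.
have uW : uniq W.
  apply: allpairs_uniq_dep => [|c _|u v]; rewrite ?filter_uniq ?iota_uniq //.
  move=> /allpairsPdep[c [i [Hc Hi ->]]] /allpairsPdep[d [j [Hd Hj ->]]] /= E.
  move: Hc Hd Hi Hj E; rewrite !mem_filter !mem_iota !add0n.
  move=> /andP[cn _] /andP[dn _] ic jd E.
  by have [-> ->] := turn_inj (ltn0Sn n) cn dn ic jd E.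
have WV : W =i V.
  move=> s; apply/allpairsPdep/mapP => [[c [i [Hc Hi ->]]]|[t Ht ->]].
    move: Hc; rewrite mem_filter => /andP[cn _].
    have Hs : size (turn x0 c n.+1 i) == n.+1 by rewrite size_mkseq.
    exists (Tuple Hs) => //; rewrite mem_enum inE; exact: turn_cycle.
  rewrite mem_enum inE in Ht.
  have tn : val t != [::] by rewrite -size_eq0 size_tuple.
  have [c [i [ct ic Et]]] := turn_surj x0 tn Ht.
  rewrite size_tuple in ct Et; exists c, i.
  by rewrite mem_filter ct cover ?mem_iota.
have := perm_size (uniq_perm uW uV WV).
rewrite size_map -cardE => <-; rewrite size_allpairs_dep sumnE big_map big_filter.
by apply: eq_bigr => c _; rewrite size_iota.
Qed.

Lemma arcs_repr_inj : injective (fun c => arcs (repr c)).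
Proof.
by move=> c d /val_inj/val_inj E; rewrite -[c]reprK -[d]reprK E.
Qed.

(** Distinct classes have distinct representatives, which are words of length k in the arcs. *)
Lemma count_class_len S k : uniq S ->
  count (fun c => class_len c == k) S <= #|{: arc G}| ^ k.
Proof.
move=> uS; rewrite -card_tuple -size_filter cardE.
rewrite -(size_map (fun c => arcs (repr c))) -(size_map val (enum _)).
apply: uniq_leq_size => [|s /mapP[c]].
  by rewrite (map_inj_uniq arcs_repr_inj) filter_uniq.
rewrite mem_filter => /andP[ck _] ->.
by apply/mapP; exists (Tuple ck) => //; rewrite mem_enum.
Qed.

Lemma classes_upto n : exists S0 : {fset prim_class G},
  forall c, class_len c <= n -> c \in S0.
Proof.
(* A partial inverse of the injection of classes into words, to be applied to the finitely many
   words of length at most [n]. *)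
pose cl (s : seq (arc G)) : option (prim_class G) :=
  if pselect (exists c, arcs (repr c) = s) is left h then Some (projT1 (cid h))
  else None.
pose ws := [seq val t | k <- iota 0 n.+1, t <- enum {: k.-tuple (arc G)}].
exists [fset c in pmap cl ws]%fset => c cn; rewrite inE /= mem_pmap.
apply/mapP; exists (arcs (repr c)).
  apply/allpairsPdep; exists (class_len c), (in_tuple (arcs (repr c))).
  by rewrite mem_iota mem_enum.
rewrite /cl; case: pselect => [h|[]]; last by exists c.
by congr Some; apply: arcs_repr_inj; rewrite (projT2 (cid h)).
Qed.

End CountingClasses.

(** * Coefficients of the Euler product *)

Section Coefficients.
Variable G : graph.
Implicit Types (c : prim_class G) (S : seq (prim_class G)).

Definition euler_poly S : {poly int} := \prod_(c <- S) (1 - 'X^(class_len c)).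

Definition det_poly : {poly int} := \det (1%:M - 'X *: adjmx {poly int} G).

Lemma map_adjmx (K K' : nzRingType) (f : {rmorphism K -> K'}) :
  map_mx f (adjmx K G) = adjmx K' G.
Proof. by apply/matrixP => i j; rewrite !mxE rmorph_nat. Qed.

Lemma horner_det_poly (K : comNzRingType) (u : K) :
  (map_poly intr det_poly).[u] = \det (1%:M - u *: adjmx K G).
Proof.
rewrite -[LHS]/(horner_eval u _) /det_poly -!det_map_mx; congr (\det _).
apply/matrixP => i j; rewrite !mxE /= /horner_eval.
rewrite rmorphB rmorphM /= map_polyX !rmorph_nat !hornerE /=.
by rewrite -!(rmorph_nat (@polyC K)) !hornerC.
Qed.

Lemma det_poly0 : det_poly`_0 = 1.
Proof.
rewrite -horner_coef0.
have := horner_det_poly (0 : int); rewrite scale0r subr0 det1 => <-.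
by rewrite map_poly_id // => x _; rewrite intz.
Qed.

Lemma euler_poly0 S : (euler_poly S)`_0 = 1.
Proof.
rewrite -horner_coef0 horner_prod big1 // => c _.
by rewrite !hornerE expr0n -leqn0 leqNgt class_len_gt0 /= subr0.
Qed.

(** Logarithmic derivatives are compared modulo X^(n+1). A class whose length divides some positive
    k <= n is no longer than n, so [S] contains every class counted by the traces. *)
Lemma coef_euler_poly S n : uniq S ->
  (forall c, (class_len c <= n)%N -> c \in S) ->
  (euler_poly S)`_n = det_poly`_n.
Proof.
move=> uS cover.
have HP := logderiv_prod S (fun c => logderiv_1subXn int n.+1 (class_len_gt0 c)).
have := logderiv_det n.+1 (adjmx int G); rewrite map_adjmx => HD.
have coefS k : (k < n.+1)%N ->
  (\sum_(c <- S) \poly_(k < n.+1) ((class_len c)%:R *+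
     ((0 < k)%N && (class_len c %| k)%N)) : {poly int})`_k
  = \sum_(c <- S) (class_len c)%:R *+ ((0 < k)%N && (class_len c %| k)%N).
  by move=> kn; rewrite coef_sum; apply: eq_bigr => c _; rewrite coef_poly kn.
apply: (logderiv_inj (euler_poly0 S) det_poly0 _ _ HP HD); rewrite ?ltnSn //.
  by rewrite coefS // big1.
move=> [|k] kn; rewrite coefS // coef_poly kn; first by rewrite big1.
rewrite mxtrace_iter_adjmx -(sum_class_len uS) => [|c ck]; last first.
  by apply: cover; apply: leq_trans (dvdn_leq _ ck) _.
rewrite natr_sum [RHS]big_mkcond; apply: eq_bigr => c _ /=.
by case: dvdn.
Qed.

End Coefficients.

(** * Bounds for coefficients of products and for tails *)

Section Majorant.
Variable K : numFieldType.

(** Induction from (1 + x)(1 - x - s) <= 1 - s. A sum of at most 1/2 thus bounds the product by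
    2. *)
Lemma prod1D_le (I : Type) (s : seq I) (x : I -> K) :
  (forall i, 0 <= x i) -> \sum_(i <- s) x i <= 1 ->
  \prod_(i <- s) (1 + x i) * (1 - \sum_(i <- s) x i) <= 1.
Proof.
move=> x0; elim: s => [|i s IHs]; first by rewrite !big_nil mul1r subr0.
rewrite !big_cons => H.
have sum_le : \sum_(j <- s) x j <= 1 by apply: le_trans H; rewrite lerDr.
apply: le_trans (IHs sum_le).
rewrite mulrAC mulrC; apply: ler_wpM2l.
  by apply: prodr_ge0 => j _; rewrite addr_ge0.
have -> : (1 + x i) * (1 - (x i + \sum_(j <- s) x j)) =
  1 - \sum_(j <- s) x j - (x i * x i + x i * \sum_(j <- s) x j) by ring.
by rewrite lerBlDr lerDl addr_ge0 // mulr_ge0 // sumr_ge0.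
Qed.

(** Changing the signs to plus majorizes all coefficients, and a single term of a polynomial with
    nonnegative coefficients is at most its value at [r]. *)
Lemma norm_coef_prod_1subXn (I : Type) (s : seq I) (l : I -> nat) (r : K) k :
  0 < r -> `|(\prod_(i <- s) (1 - 'X^(l i)) : {poly K})`_k| * r ^+ k <=
  \prod_(i <- s) (1 + r ^+ l i).
Proof.
move=> r0; have maj j : `|(\prod_(i <- s) (1 - 'X^(l i)) : {poly K})`_j| <=
    (\prod_(i <- s) (1 + 'X^(l i)) : {poly K})`_j.
  elim: s j => [|i s IHs] j.
    by rewrite !big_nil coef1 normr_nat.
  rewrite !big_cons mulrBl mulrDl !mul1r coefB coefD !coefXnM.
  apply: (le_trans (ler_normB _ _)); apply: lerD => //.
  by case: ifP => _; rewrite ?normr0.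
pose q : {poly K} := \prod_(i <- s) (1 + 'X^(l i)); rewrite -/q in maj.
have -> : \prod_(i <- s) (1 + r ^+ l i) = q.[r].
  by rewrite horner_prod; apply: eq_bigr => i _; rewrite !hornerE.
apply: (@le_trans _ _ (q`_k * r ^+ k)).
  by rewrite ler_wpM2r // exprn_ge0 // ltW.
have q0 j : 0 <= q`_j * r ^+ j.
  by rewrite mulr_ge0 ?exprn_ge0 ?(ltW r0) // (le_trans _ (maj j)).
(* The range is widened so that index [k] occurs even beyond the degree. *)
rewrite (horner_coef_wide _ (leq_addl k.+1 _)).
by rewrite big_split_ord big_ord_recr /= -addrA addrCA lerDl addr_ge0 // sumr_ge0.
Qed.

Lemma geometric_le (x : K) n : 0 <= x -> x < 1 ->
  \sum_(i < n) x ^+ i <= (1 - x)^-1.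
Proof.
move=> x0 x1; rewrite -[leRHS]mul1r ler_pdivlMr ?subr_gt0 //.
rewrite mulrC -opprB mulNr -subrX1 opprB lerBlDr lerDl exprn_ge0 //.
Qed.

(** The geometric tail is C 8^-n / 7. The weaker divisor 4 will cancel C = 4 for differences and
    leave 1/2 for C = 2. *)
Lemma horner_tail_le (p : {poly K}) (u C : K) n : 0 <= C ->
  (forall k, (k <= n)%N -> p`_k = 0) ->
  (forall k, `|p`_k * u ^+ k| <= C * 8^-1 ^+ k) ->
  `|p.[u]| <= C * 8^-1 ^+ n / 4.
Proof.
move=> C0 p0 pC; rewrite (horner_coef_wide _ (leq_addl n.+1 _)) big_split_ord /=.
rewrite big1 ?add0r => [|i _]; last by rewrite p0 ?mul0r // -ltnS.
apply: (le_trans (ler_norm_sum _ _ _)).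
apply: (@le_trans _ _ (\sum_(i < size p) C * 8^-1 ^+ n.+1 * 8^-1 ^+ i)).
  by apply: ler_sum => i _; rewrite -mulrA -exprD; exact: pC.
rewrite -mulr_sumr exprSr [C * (_ * _)]mulrA -[leLHS]mulrA.
apply: ler_wpM2l; first by rewrite mulr_ge0 ?exprn_ge0 ?invr_ge0 ?ler0n.
have h8 : (8^-1 : K) < 1 by rewrite invf_lt1 ?ltr1n ?ltr0n.
apply: (@le_trans _ _ (8^-1 * (1 - 8^-1)^-1)).
  by rewrite ler_pM2l ?invr_gt0 ?ltr0n // geometric_le ?invr_ge0 ?ler0n.
have -> : (8^-1 * (1 - 8^-1)^-1 : K) = 7%:R^-1 by field.
by rewrite lef_pV2 ?posrE ?ltr0n // ler_nat.
Qed.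

End Majorant.

(** * Values near 0 *)

Section Evaluation.
Variables (K : numFieldType) (G : graph).
Implicit Types (S : seq (prim_class G)) (u : K).

(* With [q] arcs, [q.+1%:R * radius = 8^-1], so that the sum over the classes is at
   most a geometric series of ratio [8^-1]. *)
Definition radius : K := (8 * #|{: arc G}|.+1%:R)^-1.

Lemma radius_gt0 : 0 < radius.
Proof. by rewrite invr_gt0 mulr_gt0 ?ltr0n. Qed.

Lemma sum_radius_le S : uniq S ->
  \sum_(c <- S) radius ^+ class_len c <= 2^-1.
Proof.
move=> uS; have r0 := ltW radius_gt0.
pose m := \max_(c <- S) class_len c.
(* The classes are grouped by length k+1, to use the bound on their number. *)
have -> : \sum_(c <- S) radius ^+ class_len c =
    \sum_(c <- S) \sum_(k < m) (class_len c == k.+1)%:R * radius ^+ k.+1.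
  rewrite !big_seq; apply: eq_bigr => c cS.
  have cm : ((class_len c).-1 < m)%N.
    by rewrite prednK ?class_len_gt0 //; apply: (@leq_bigmax_seq _ _ predT).
  rewrite (bigD1 (Ordinal cm)) //= prednK ?class_len_gt0 // eqxx mul1r.
  rewrite big1 ?addr0 // => k; rewrite -val_eqE /= => nk.
  have := class_len_gt0 c; case: eqVneq => [E|_]; rewrite ?mul0r //.
  by rewrite E eqxx in nk.
rewrite exchange_big /=.
apply: (@le_trans _ _ (\sum_(k < m) 8^-1 * 8^-1 ^+ k)).
  apply: ler_sum => k _; rewrite -mulr_suml -exprS.
  have -> : 8^-1 = #|{: arc G}|.+1%:R * radius :> K.
    by rewrite /radius invfM mulrCA divff ?mulr1 // pnatr_eq0.
  rewrite exprMn ler_wpM2r ?exprn_ge0 // -natr_sum -natrX ler_nat.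
  rewrite (eq_bigr (fun c => if class_len c == k.+1 then 1%N else 0%N)); last first.
    by move=> c _; case: eqP.
  rewrite -big_mkcond sum1_count; apply: leq_trans (count_class_len _ uS) _.
  by rewrite leq_exp2r.
have h8 : (8^-1 : K) < 1 by rewrite invf_lt1 ?ltr1n ?ltr0n.
rewrite -mulr_sumr; apply: (@le_trans _ _ (8^-1 * (1 - 8^-1)^-1)).
  by rewrite ler_pM2l ?invr_gt0 ?ltr0n // geometric_le ?invr_ge0 ?ler0n.
have -> : (8^-1 * (1 - 8^-1)^-1 : K) = 7%:R^-1 by field.
by rewrite lef_pV2 ?posrE ?ltr0n // ler_nat.
Qed.

Lemma map_euler_poly S : map_poly intr (euler_poly S) =
  \prod_(c <- S) (1 - 'X^(class_len c)) :> {poly K}.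
Proof.
rewrite /euler_poly rmorph_prod; apply: eq_bigr => c _.
by rewrite rmorphB rmorph1 /= map_polyXn.
Qed.

Lemma coef_euler_poly_le S k : uniq S ->
  `|((euler_poly S)`_k)%:~R : K| * radius ^+ k <= 2.
Proof.
move=> uS; have r0 := radius_gt0; have Sr := sum_radius_le uS.
rewrite -coef_map /= map_euler_poly.
apply: (le_trans (norm_coef_prod_1subXn _ _ _ r0)).
have half1 : 2^-1 <= 1 :> K by rewrite invf_le1 ?ler1n ?ltr0n.
have x0 (c : prim_class G) : 0 <= radius ^+ class_len c by rewrite exprn_ge0 // ltW.
have := prod1D_le x0 (le_trans Sr half1).
set Q := \prod_(c <- S) _; set s := \sum_(c <- S) _ => H.
have Q0 : 0 <= Q by apply: prodr_ge0 => c _; rewrite addr_ge0.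
rewrite -[leRHS]mul1r -ler_pdivrMr ?ltr0n //; apply: le_trans H.
rewrite ler_wpM2l // lerBrDr -lerBrDl (le_trans Sr) //.
by rewrite le_eqVlt; apply/orP; left; apply/eqP; field.
Qed.

(** Shrinking the radius by another factor 8 turns the bound 2, uniform in [S], into geometric
    decay. *)
Lemma coef_euler_poly_expr_le S k u : uniq S -> `|u| <= radius / 8 ->
  `|((euler_poly S)`_k)%:~R * u ^+ k| <= 2 * 8^-1 ^+ k.
Proof.
move=> uS ur; rewrite normrM normrX.
apply: (@le_trans _ _ (`|((euler_poly S)`_k)%:~R| * (radius / 8) ^+ k)).
  rewrite ler_wpM2l // lerXn2r ?nnegrE //.
  by rewrite divr_ge0 ?ler0n // ltW // radius_gt0.
rewrite exprMn mulrA ler_wpM2r ?coef_euler_poly_le //.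
Qed.

(** Each coefficient of the determinant is one of some finite Euler product, so it inherits the
    uniform bound. *)
Lemma coef_det_poly_expr_le k u : `|u| <= radius / 8 ->
  `|((det_poly G)`_k)%:~R * u ^+ k| <= 2 * 8^-1 ^+ k.
Proof.
move=> ur; have [S0 HS0] := classes_upto G k.
rewrite -(coef_euler_poly (fset_uniq S0) HS0).
exact: coef_euler_poly_expr_le (fset_uniq S0) ur.
Qed.

(** The determinant differs from its constant term 1 by at most 2/4. *)
Lemma det_neq0 u : `|u| <= radius / 8 -> \det (1%:M - u *: adjmx K G) != 0.
Proof.
move=> ur; rewrite -horner_det_poly; set p := map_poly _ _.
have C0 : 0 <= 2 :> K by rewrite ler0n.
have p0 k : (k <= 0)%N -> (p - 1)`_k = 0.
  by rewrite leqn0 => /eqP ->; rewrite coefB coef_map coef1 /= det_poly0 subrr.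
have pk k : `|(p - 1)`_k * u ^+ k| <= 2 * 8^-1 ^+ k.
  case: k => [|k].
    by rewrite p0 // mul0r normr0 mulr_ge0 ?exprn_ge0 ?invr_ge0 ?ler0n.
  by rewrite coefB coef_map coef1 subr0; exact: coef_det_poly_expr_le.
have := horner_tail_le C0 p0 pk; rewrite expr0 mulr1 hornerD hornerN hornerC => H.
apply/eqP => pu; move: H; rewrite pu sub0r normrN normr1.
rewrite ler_pdivlMr ?ltr0n // mul1r ler_nat //.
Qed.

(** The difference has no terms up to degree [n], and the two bounds add up to 4 times 8^-k
    beyond. *)
Lemma euler_prod_dist S n u : uniq S ->
  (forall c : prim_class G, (class_len c <= n)%N -> c \in S) ->
  `|u| <= radius / 8 ->
  `|\det (1%:M - u *: adjmx K G) - \prod_(c <- S) (1 - u ^+ class_len c)|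
    <= 8^-1 ^+ n.
Proof.
move=> uS cover ur; rewrite -horner_det_poly.
have -> : \prod_(c <- S) (1 - u ^+ class_len c) =
    (map_poly intr (euler_poly S)).[u].
  rewrite map_euler_poly horner_prod; apply: eq_bigr => c _.
  by rewrite !hornerE.
rewrite -hornerN -hornerD -rmorphB /=; set p := map_poly _ _.
have C0 : 0 <= 4 :> K by rewrite ler0n.
have pE k : p`_k = ((det_poly G)`_k)%:~R - ((euler_poly S)`_k)%:~R.
  by rewrite coef_map /= coefB rmorphB.
have p0 k : (k <= n)%N -> p`_k = 0.
  move=> kn; rewrite pE coef_euler_poly ?subrr // => c ck.
  exact: cover (leq_trans ck kn).
have pk k : `|p`_k * u ^+ k| <= 4 * 8^-1 ^+ k.
  have E4 : 4 = 2 + 2 :> K by rewrite -natrD.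
  rewrite pE mulrBl E4 mulrDl; apply: (le_trans (ler_normB _ _)).
  by apply: lerD; [exact: coef_det_poly_expr_le|exact: coef_euler_poly_expr_le].
have := horner_tail_le C0 p0 pk.
by rewrite mulrAC divff ?mul1r // pnatr_eq0.
Qed.

End Evaluation.

(** * Inverse series and convergence of the Euler product *)

Lemma fps_inverse_poly (R : comNzRingType) (p : {poly R}) : p`_0 = 1 ->
  exists z, fps_inverse z (fps_poly p).
Proof.
(* The inverse of 1 - g is the sum of the g^k; as g has no constant term, coefficient [n] only
   involves k <= n. *)
move=> p0; pose g := 1 - p.
pose Z n := \sum_(k < n.+1) g ^+ k.
have gX k n : (n < k)%N -> (g ^+ k)`_n = 0.
  have [h ->] : exists h, g = 'X * h.
    exists (drop_poly 1 g); rewrite -{1}(poly_take_drop 1 g) expr1 mulrC.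
    rewrite (_ : take_poly 1 g = 0) ?add0r //; apply/polyP => -[|i].
      by rewrite coef_take_poly coefB coef1 p0 subrr coef0.
    by rewrite coef_take_poly coef0.
  by move=> nk; rewrite exprMn coefXnM nk.
have ZE n m : (m <= n)%N -> (Z m)`_m = (Z n)`_m.
  move=> mn; rewrite /Z -(subnKC mn) -addSn big_split_ord /= coefD.
  rewrite [X in _ = _ + X]coef_sum [X in _ = _ + X]big1 ?addr0 // => i _.
  by rewrite gX // leq_addr.
have pZ n : (p * Z n)`_n = (1 : {poly R})`_n.
  have -> : p * Z n = 1 - g ^+ n.+1.
    have -> : p = - (g - 1) by rewrite /g; ring.
    by rewrite mulNr -subrX1 opprB.
  by rewrite coefB gX // subr0.
exists (fun n => (Z n)`_n); split; apply: funext => n; rewrite /fps_mul /fps_poly.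
  rewrite -pZ mulrC coefM; apply: eq_bigr => i _.
  by rewrite (ZE n) // -ltnS.
by rewrite -pZ coefM; apply: eq_bigr => i _; rewrite (ZE n) // leq_subr.
Qed.

Section EulerProduct.
Variable G : graph.

Lemma euler_poly_cvg :
  fps_prod_cvg (fun c : prim_class G => 1 - 'X^(class_len c))
    (fps_poly (det_poly G)).
Proof.
move=> n; have [S0 HS0] := classes_upto G n.
exists S0 => // S /fsubsetP S0S.
by apply: (coef_euler_poly (fset_uniq S)) => c /HS0/S0S.
Qed.

Lemma fps_prod_cvg_unique (R : comNzRingType) (I : choiceType)
    (F : I -> {poly R}) (f g : fps R) :
  fps_prod_cvg F f -> fps_prod_cvg F g -> f = g.
Proof.
move=> Ff Fg; apply: funext => n; have PF : ProperFilter (@totally I) := totally_filter.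
by have [S [<- <-]] := filter_ex (filterI (Ff n) (Fg n)).
Qed.

Lemma euler_prod_cvg (R : realType) (u : R[i]) :
  `|u| <= radius R[i] G / 8 ->
  (fun S : {fset prim_class G} => \prod_(c <- S) (1 - u ^+ class_len c))
    @ totally --> (\det (1%:M - u *: adjmx R[i] G) : R[i]^o).
Proof.
move=> ur; have PF : ProperFilter (@totally (prim_class G)) := totally_filter.
apply/(@cvgrPdist_le R[i] R[i]^o _ totally) => e e0.
have [n ne] : exists n, 8^-1 ^+ n <= e.
  (* A positive complex number is real, so the Archimedean property of [R] applies to 1/a. *)
  case: e e0 => a b; rewrite ltcE /= => /andP[/eqP -> a0].
  exists (Num.truncn a^-1).+1.
  rewrite -[Complex a 0]/(real_complex R a) -[8](rmorph_nat (real_complex R)).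
  rewrite -fmorphV -rmorphXn /=.
  rewrite lecR exprVn -[leRHS]invrK lef_pV2 ?posrE ?invr_gt0 ?exprn_gt0 ?ltr0n //.
  apply/ltW/(lt_le_trans (truncnS_gt _)); rewrite -natrX ler_nat.
  by apply: ltnW; rewrite ltn_expl.
have [S0 HS0] := classes_upto G n.
exists S0 => // S /fsubsetP S0S; apply: le_trans ne.
by apply: (euler_prod_dist (fset_uniq S)) => // c /HS0/S0S.
Qed.

End EulerProduct.

Theorem theorem15p1 (R : realType) (G : graph) :
  ((exists z : fps int, is_zeta_fps G z) /\
   (forall z : fps int, is_zeta_fps G z ->
      fps_inverse z (fps_poly (\det (1%:M - 'X *: adjmx {poly int} G)))))
  /\
  (\forall u \near (0 : R[i]^o),
     (exists z : R[i], is_zeta_at G u z) /\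
     (forall z : R[i], is_zeta_at G u z ->
        z^-1 = \det (1%:M - u *: adjmx R[i] G))).
Proof.
split.
  split=> [|z [f zf Ff]].
    have [z Hz] := fps_inverse_poly (det_poly0 G).
    by exists z, (fps_poly (det_poly G)) => //; exact: euler_poly_cvg.
  by rewrite -(fps_prod_cvg_unique Ff (@euler_poly_cvg G)).
have r0 : 0 < radius R[i] G / 8 by rewrite divr_gt0 ?radius_gt0 ?ltr0n.
apply: filterS (nbhs0_le r0) => u /= ur; split=> [|z [_ Hz]].
  exists (\det (1%:M - u *: adjmx R[i] G))^-1; split.
    by rewrite invr_eq0 det_neq0.
  by rewrite invrK; exact: euler_prod_cvg.
have PF : ProperFilter (@totally (prim_class G)) := totally_filter.
apply: (@cvg_unique _ (@norm_hausdorff _ R[i]^o) _ _ _ _ Hz).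
exact: euler_prod_cvg.
Qed.
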